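(* Let $K$ be a field, let $P$ be a finite poset and let $T$ be a $KP$-algebra such that $T_x$ is an algebra with straightening law (ASL) on $(0_{\widehat P},x]^{\mathrm{op}}$ over $K$ for every $x\in P$. For $x\in P$ let $\phi_x\colon K[(0_{\widehat P},x]]\to T_x$ be the natural projection induced by the ASL-structure on $T_x$. Suppose that for all $x,y\in P$ with $x\le y$ one has $$T_{xy}\circ\phi_y=\phi_x\circ p_{(0_{\widehat P},x](0_{\widehat P},y]}$$ as maps $K[(0_{\widehat P},y]]\to T_x$. Then $\lim_P T$ is an ASL on $P^{\mathrm{op}}$ over $K$. In particular, if $\mathcal S\subseteq\mathbb N^P$ denotes the set of standard monomials in $K[P]$, then $$\lim_P T\cong K[P]/I_P,$$ where the ideal $I_P$ is generated by the relations $$n-\sum_{m\in\mathcal S} r_{m,n}\,m\qquad\text{for } n\in\mathbb N^P,$$ where $\phi(n)=\sum_{m\in\mathcal S} r_{m,n}\,\phi(m)$ is the unique representation of the monomial $\phi(n)$ in $\lim_P T$ as a $K$-linear combination of standard monomials.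
   Context: A $KP$-algebra $T$ on a poset $P$ is a system of commutative $K$-algebras $(T_x)_{x\in P}$ together with $K$-algebra homomorphisms $T_{xy}\colon T_y\to T_x$ for $x\le y$ such that $T_{xx}=\mathrm{id}$ and $T_{xy}\circ T_{yz}=T_{xz}$ for $x\le y\le z$. Its limit is $\lim_P T=\{(s_x)_{x\in P}\in\prod_{x\in P}T_x : T_{xy}(s_y)=s_x \text{ for all } x\le y\}$. For $x\in P$, $(0_{\widehat P},x]=\{y\in P: y\le x\}$. $P^{\mathrm{op}}$ is the opposite poset. For a subset $Q$ of $P$, $K[Q]$ is the polynomial ring on the elements of $Q$ as variables; for $Q'\subseteq Q\subseteq P$ the $K$-algebra homomorphism $p_{Q'Q}\colon K[Q]\to K[Q']$ sends $x\mapsto x$ if $x\in Q'$ and $x\mapsto 0$ if $x\notin Q'$. A monomial on $P$ is a function $m\in\mathbb N^P$, regarded as a monomial of $K[P]$; its support is $\operatorname{supp}(m)=\{x: m(x)\ne0\}$, and $m$ is called standard if $\operatorname{supp}(m)$ is a chain (totally ordered subset) in $P$. Let $A$ be a $K$-algebra with an injection $\phi\colon P\to A$, and put $\phi(m)=\prod_{x\in P}\phi(x)^{m(x)}$. Then $A$ is called an algebra with straightening law (ASL) on $P^{\mathrm{op}}$ over $K$ if: (ASL1) the (images $\phi(m)$ of the) standard monomials form a $K$-basis of $A$; (ASL2) if $x,y\in P$ are incomparable and $\phi(x)\phi(y)=\sum_m r_{m,xy}\phi(m)$ is the unique representation as a linear combination of standard monomials, then $r_{m,xy}\ne0$ implies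 that the maximal element $x_m$ of $\operatorname{supp}(m)$ satisfies $x<x_m$ and $y<x_m$. The injection $\phi$ extends to the $K$-algebra homomorphism $K[P]\to A$, called the natural projection induced by the ASL-structure. For $\lim_P T$ the ASL-structure is with respect to the map $\phi\colon K[P]\to\lim_P T$ induced by the compositions $K[P]\to K[(0_{\widehat P},x]]\xrightarrow{\phi_x}T_x$, $x\in P$.
   Formalization: The finite poset P is additionally assumed nonempty and connected (comparability graph); otherwise the claim is false: for an antichain {x,y} with T_x=K[x], T_y=K[y], the limit K[x]×K[y] is not spanned by standard monomials, and for empty P the limit is 0. *)

(* Defs.v *)
From HB Require Import structures.
From mathcomp Require Import all_boot all_order all_algebra finmap.
From mathcomp.multinomials Require Import monalg.
From mathcomp Require Import boolp.

Set Implicit Arguments.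
Unset Strict Implicit.
Unset Printing Implicit Defensive.

Import Order.TTheory GRing.Theory.

Local Open Scope ring_scope.
Local Open Scope quotient_scope.

(* For a finite type Q, [{cmonom Q}] is N^Q, and [{malg K[{cmonom Q}]}] is    *)
(* the polynomial ring K[Q] whose variables are the elements of Q.            *)
Notation polyring K Q := {malg K[{cmonom Q}]}.
Definition polyvar (K : fieldType) (Q : finType) (q : Q) : polyring K Q :=
  << @ucm Q q >>.
Notation "''x_' q" := (polyvar _ q) (at level 8, q at level 2) : ring_scope.

Section NaturalProjection.
Context (K : fieldType) (Q : finType) (A : comAlgType K) (phi : Q -> A).

Definition monom_eval (m : {cmonom Q}) : A := \prod_(x : Q) phi x ^+ m x.

Lemma monom_eval_mmorphism : mmorphism monom_eval.
Proof.
split=> [m1 m2|]; rewrite /monom_eval.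
  by rewrite -big_split; apply: eq_bigr => x _; rewrite cmM exprD.
by rewrite big1 // => x _; rewrite cm1.
Qed.

HB.instance Definition _ :=
  isMultiplicative.Build {cmonom Q} A monom_eval monom_eval_mmorphism.

Definition natproj : polyring K Q -> A := mmap (in_alg A) monom_eval.

HB.instance Definition _ := GRing.RMorphism.on natproj.

Lemma natproj_is_scalable : scalable natproj.
Proof. by move=> c p; rewrite /natproj mmapZ /= mulr_algl. Qed.

HB.instance Definition _ :=
  GRing.isScalable.Build K (polyring K Q) A *:%R natproj natproj_is_scalable.

Lemma natproj_monom m : natproj << m >> = monom_eval m.
Proof. by rewrite /natproj mmapU /= scale1r mul1r. Qed.

Lemma natproj_var x : natproj 'x_x = phi x.
Proof.
rewrite /polyvar natproj_monom /monom_eval (bigD1 x) //= cmUU expr1 big1 ?mulr1 //.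
by move=> y /negPf yx; rewrite cmU eq_sym yx.
Qed.

End NaturalProjection.

Section Monomials.
Context (K : fieldType) (Q : finType).
Implicit Types (m : {cmonom Q}) (x : Q).

Lemma polyring_monomM m1 m2 :
  << m1 >> * << m2 >> = << mmul m1 m2 >> :> polyring K Q.
Proof. by have := @fgmulUU _ K 1 1 m1 m2; rewrite -malgM_def mulr1. Qed.

Lemma polyring_monomZ (c : K) m : << c *g m >> = c *: << m >> :> polyring K Q.
Proof.
apply/malgP => k; rewrite (@mcoeffZ _ K c << m >> k).
have U (a : K) : (<< a *g m >> : polyring K Q)@_k = a *+ (m == k).
  exact: mcoeffU.
by apply: etrans (U c) _; rewrite (U 1) mulrnAr mulr1.
Qed.

Lemma polyring_monomE m : << m >> = \prod_(x : Q) 'x_x ^+ m x :> polyring K Q.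
Proof.
have UX x n : 'x_x ^+ n = << iter n (mmul (@ucm Q x)) mone >> :> polyring K Q.
  elim: n => [|n IH]; first by rewrite expr0.
  by rewrite exprS IH; apply: polyring_monomM.
have iterE x y n :
    (iter n (mmul (@ucm Q x)) mone : {cmonom Q}) y = (n * (x == y))%N.
  by elim: n => [|n IH] /=; rewrite ?cm1 // cmM cmU IH mulSn.
have prodU (s : seq Q) (e : Q -> {cmonom Q}) :
    \prod_(x <- s) << e x >> = << \big[mmul/mone]_(x <- s) e x >>
    :> polyring K Q.
  elim: s => [|x s IH]; first by rewrite !big_nil.
  by rewrite !big_cons IH; apply: polyring_monomM.
under eq_bigr do rewrite UX.
rewrite prodU; congr (<< _ >>); apply/eqP/cmP => y.
have -> (s : seq Q) (e : Q -> {cmonom Q}) :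
    (\big[mmul/mone]_(x <- s) e x) y = (\sum_(x <- s) e x y)%N.
  elim: s => [|x s IH]; first by rewrite !big_nil cm1.
  by rewrite !big_cons cmM IH.
rewrite (bigD1 y) //= iterE eqxx muln1 big1 ?addn0 // => x /negPf xy.
by rewrite iterE xy muln0.
Qed.

Lemma polyring_hom_ext (A : comAlgType K) (f g : {lrmorphism polyring K Q -> A}) :
  (forall x, f 'x_x = g 'x_x) -> f =1 g.
Proof.
move=> fg p; rewrite [p]monalgE !raddf_sum; apply: eq_bigr => m _ /=.
rewrite polyring_monomZ !linearZ polyring_monomE !rmorph_prod.
by congr (_ *: _); apply: eq_bigr => x _ /=; rewrite !rmorphXn; congr (_ ^+ _); apply: fg.
Qed.

End Monomials.

(* The K-algebra map sending the variable x to the variable x' if             *)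
(* f x = Some x' and to 0 if f x = None; for Q' a subtype of Q and f = insub  *)
(* this is K[Q] -> K[Q'].                                                     *)
Definition polyproj (K : fieldType) (Q Q' : finType) (f : Q -> option Q') :
    polyring K Q -> polyring K Q' :=
  natproj (fun x => if f x is Some x' then 'x_x' else 0 : polyring K Q').

HB.instance Definition _ (K : fieldType) (Q Q' : finType)
  (f : Q -> option Q') := GRing.LRMorphism.on (@polyproj K Q Q' f).

Section ASL.
Context (K : fieldType) (d : Order.disp_t) (Q : finPOrderType d).

Definition standard (m : {cmonom Q}) : Prop :=
  forall x y : Q, m x != 0%N -> m y != 0%N -> (x >=< y)%O.

(* Linear combinations of standard monomials, as elements of K[Q]. *)
Definition std_comb (p : polyring K Q) : Prop :=
  forall m, p@_m != 0 -> standard m.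

(* The structure map [phi] makes A an ASL on the OPPOSITE poset of Q, which   *)
(* is why the straightening condition involves maximal elements of supports.  *)
(* [asl_free] and [asl_span] say that the family (phi(m)), m standard, is a   *)
(* K-basis of A.                                                              *)
Record is_asl_op (A : comAlgType K) (phi : Q -> A) : Prop := IsAslOp {
  asl_inj : injective phi;
  asl_free : forall p, std_comb p -> natproj phi p = 0 -> p = 0;
  asl_span : forall a : A, exists2 p, std_comb p & natproj phi p = a;
  asl_straight : forall (x y : Q) (r : polyring K Q),
    (x >< y)%O -> std_comb r -> phi x * phi y = natproj phi r ->
    forall m, r@_m != 0 ->
      exists z : Q, [/\ m z != 0%N, (forall w, m w != 0%N -> (w <= z)%O),
                        (x < z)%O & (y < z)%O]
}.

End ASL.

Section Below.
Context (d : Order.disp_t) (P : finPOrderType d) (x : P).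

(* The half-open interval (0, x] with the induced order. *)
Definition below : predArgType := {y : P | (y <= x)%O}.

HB.instance Definition _ := Finite.on below.
HB.instance Definition _ := SubType.on below.
HB.instance Definition _ := [SubChoice_isSubPOrder of below by <: with d].

End Below.

(* Connectedness of the comparability graph. The limit over a disjoint union  *)
(* of two nonempty posets without relations between them is the product of    *)
(* the two limits, and its idempotent (1, 0) is not a polynomial in the       *)
(* generators; so the limit is an ASL only over connected nonempty posets.    *)
Definition connected_poset (d : Order.disp_t) (P : finPOrderType d) : Prop :=
  forall x y : P, connect (fun u v : P => (u >=< v)%O) x y.

Record kp_algebra (K : fieldType) (d : Order.disp_t) (P : finPOrderType d) :=
  KPAlgebra {
    kp_obj :> P -> comAlgType K;
    kp_map : forall x y : P,
      (x <= y)%O -> {lrmorphism kp_obj y -> kp_obj x};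
    kp_map_id : forall (x : P) (h : (x <= x)%O) a, kp_map h a = a;
    kp_map_comp : forall (x y z : P)
      (xy : (x <= y)%O) (yz : (y <= z)%O) (xz : (x <= z)%O) a,
      kp_map xy (kp_map yz a) = kp_map xz a
  }.

Section Product.
Context (K : fieldType) (d : Order.disp_t) (P : finPOrderType d).
Context (T : kp_algebra K P).

Definition kp_prod : Type := {dffun forall x : P, T x}.

HB.instance Definition _ := Choice.on kp_prod.

Implicit Types s t : kp_prod.
Let mk (f : forall x : P, T x) : kp_prod := [ffun x => f x].

Let zero := mk (fun=> 0).
Let opp s := mk (fun x => - s x).
Let add s t := mk (fun x => s x + t x).
Let one := mk (fun=> 1).
Let mul s t := mk (fun x => s x * t x).
Let scale (k : K) s := mk (fun x => k *: s x).

Fact kp_prod_addA : associative add.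
Proof. by move=> s t u; apply/ffunP=> x; rewrite !ffunE addrA. Qed.
Fact kp_prod_addC : commutative add.
Proof. by move=> s t; apply/ffunP=> x; rewrite !ffunE addrC. Qed.
Fact kp_prod_add0 : left_id zero add.
Proof. by move=> s; apply/ffunP=> x; rewrite !ffunE add0r. Qed.
Fact kp_prod_addN : left_inverse zero opp add.
Proof. by move=> s; apply/ffunP=> x; rewrite !ffunE addNr. Qed.

HB.instance Definition _ := GRing.isZmodule.Build kp_prod
  kp_prod_addA kp_prod_addC kp_prod_add0 kp_prod_addN.

Fact kp_prod_mulA : associative mul.
Proof. by move=> s t u; apply/ffunP=> x; rewrite !ffunE mulrA. Qed.
Fact kp_prod_mulC : commutative mul.
Proof. by move=> s t; apply/ffunP=> x; rewrite !ffunE mulrC. Qed.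
Fact kp_prod_mul1 : left_id one mul.
Proof. by move=> s; apply/ffunP=> x; rewrite !ffunE mul1r. Qed.
Fact kp_prod_mulD : left_distributive mul add.
Proof. by move=> s t u; apply/ffunP=> x; rewrite !ffunE mulrDl. Qed.

HB.instance Definition _ := GRing.Zmodule_isComPzRing.Build kp_prod
  kp_prod_mulA kp_prod_mulC kp_prod_mul1 kp_prod_mulD.

Fact kp_prod_scaleA a b s : scale a (scale b s) = scale (a * b) s.
Proof. by apply/ffunP=> x; rewrite !ffunE scalerA. Qed.
Fact kp_prod_scale1 : left_id 1 scale.
Proof. by move=> s; apply/ffunP=> x; rewrite !ffunE scale1r. Qed.
Fact kp_prod_scaleDr : right_distributive scale +%R.
Proof. by move=> a s t; apply/ffunP=> x; rewrite !ffunE scalerDr. Qed.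
Fact kp_prod_scaleDl s : {morph scale^~ s : a b / a + b}.
Proof. by move=> a b; apply/ffunP=> x; rewrite !ffunE scalerDl. Qed.

HB.instance Definition _ := GRing.Zmodule_isLmodule.Build K kp_prod
  kp_prod_scaleA kp_prod_scale1 kp_prod_scaleDr kp_prod_scaleDl.

Lemma kp_prod0E x : (0 : kp_prod) x = 0. Proof. exact: ffunE. Qed.
Lemma kp_prodNE s x : (- s) x = - s x. Proof. exact: ffunE. Qed.
Lemma kp_prodDE s t x : (s + t) x = s x + t x. Proof. exact: ffunE. Qed.
Lemma kp_prod1E x : (1 : kp_prod) x = 1. Proof. exact: ffunE. Qed.
Lemma kp_prodME s t x : (s * t) x = s x * t x. Proof. exact: ffunE. Qed.
Lemma kp_prodZE k s x : (k *: s) x = k *: s x. Proof. exact: ffunE. Qed.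

End Product.

Definition kp_prodE := (kp_prod0E, kp_prodNE, kp_prodDE, kp_prod1E,
  kp_prodME, kp_prodZE).

Section Limit.
Context (K : fieldType) (d : Order.disp_t) (P : finPOrderType d).
Context (T : kp_algebra K P).

Definition lim_pred : {pred kp_prod T} :=
  fun s => `[< forall (x y : P) (h : (x <= y)%O), kp_map T h (s y) = s x >].

Fact lim_subring_closed : subring_closed lim_pred.
Proof.
split; first by apply/asboolP => x y h; rewrite !kp_prodE rmorph1.
  move=> s t /asboolP hs /asboolP ht; apply/asboolP => x y h.
  by rewrite !kp_prodE raddfB /= hs ht.
move=> s t /asboolP hs /asboolP ht; apply/asboolP => x y h.
by rewrite !kp_prodE rmorphM /= hs ht.
Qed.

Fact lim_scaler_closed : GRing.scaler_closed lim_pred.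
Proof.
move=> k s /asboolP hs; apply/asboolP => x y h.
by rewrite !kp_prodE linearZ /= hs.
Qed.

HB.instance Definition _ :=
  GRing.isSubringClosed.Build (kp_prod T) lim_pred lim_subring_closed.
HB.instance Definition _ :=
  GRing.isScaleClosed.Build K (kp_prod T) lim_pred lim_scaler_closed.

Record lim : predArgType :=
  Lim { lim_val : kp_prod T; _ : lim_val \in lim_pred }.

HB.instance Definition _ := [isSub for lim_val].
HB.instance Definition _ := [Choice of lim by <:].
HB.instance Definition _ := GRing.SubChoice_isSubComPzRing.Build _ _ lim
  (GRing.subringClosedP lim_pred).
HB.instance Definition _ := [SubZmodule_isSubLmodule of lim by <:].

Definition lim_at (s : lim) (x : P) : T x := lim_val s x.

Lemma limP (s : lim) (x y : P) (h : (x <= y)%O) :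
  kp_map T h (lim_at s y) = lim_at s x.
Proof. by move: (valP s) => /asboolP; apply. Qed.

End Limit.

Section LimitAlgebra.
Context (K : fieldType) (d : Order.disp_t) (P : finPOrderType d).
Context (T : kp_algebra K P) (P_gt0 : (0 < #|P|)%N).

(* MathComp algebras are non-trivial rings; the limit over the empty poset is *)
(* the zero ring, so the [comAlgType] structure on the limit needs P_gt0.     *)
Definition lim_alg of (0 < #|P|)%N : predArgType := lim T.
Notation L := (lim_alg P_gt0).

HB.instance Definition _ := GRing.ComPzRing.on L.
HB.instance Definition _ := GRing.Lmodule.on L.

Fact lim_alg_nonzero : (1 : L) != 0.
Proof.
apply/eqP => /(congr1 (@lim_val _ _ _ T)).
have [x _] := card_gt0P P_gt0.
move=> /ffunP/(_ x)/eqP; rewrite !ffunE.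
by rewrite oner_eq0.
Qed.

HB.instance Definition _ := GRing.PzSemiRing_isNonZero.Build L lim_alg_nonzero.

Fact lim_alg_scaleAl (k : K) (s t : L) : k *: (s * t) = (k *: s) * t.
Proof.
by apply/val_inj/ffunP => x /=; rewrite !kp_prodE scalerAl.
Qed.

HB.instance Definition _ := GRing.Lmodule_isLalgebra.Build K L lim_alg_scaleAl.
HB.instance Definition _ := GRing.Lalgebra_isComAlgebra.Build K L.

Implicit Types s t : L.

Lemma lim_atN s x : lim_at (- s) x = - lim_at s x.
Proof. exact: kp_prodNE. Qed.
Lemma lim_atD s t x : lim_at (s + t) x = lim_at s x + lim_at t x.
Proof. exact: kp_prodDE. Qed.
Lemma lim_at1 x : lim_at (1 : L) x = 1.
Proof. exact: kp_prod1E. Qed.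
Lemma lim_atM s t x : lim_at (s * t) x = lim_at s x * lim_at t x.
Proof. exact: kp_prodME. Qed.
Lemma lim_atZ (k : K) s x : lim_at (k *: s) x = k *: lim_at s x.
Proof. exact: kp_prodZE. Qed.
Lemma lim_ext s t : (forall x, lim_at s x = lim_at t x) -> s = t.
Proof. by move=> st; apply/val_inj/ffunP. Qed.

End LimitAlgebra.

Section LimitMap.
Context (K : fieldType) (d : Order.disp_t) (P : finPOrderType d).
Context (T : kp_algebra K P) (phi : forall x : P, below x -> T x).

(* K[P] -> K[(0, x]] *)
Definition proj_all (x : P) : polyring K P -> polyring K (below x) :=
  polyproj insub.

(* K[(0, y]] -> K[(0, x]], meant for x <= y *)
Definition proj_below (x y : P) :
    polyring K (below y) -> polyring K (below x) :=
  polyproj (fun z => insub (val z)).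

HB.instance Definition _ x := GRing.LRMorphism.on (proj_all x).
HB.instance Definition _ x y := GRing.LRMorphism.on (@proj_below x y).

Definition kp_compatible : Prop :=
  forall (x y : P) (h : (x <= y)%O) (p : polyring K (below y)),
    kp_map T h (natproj (@phi y) p) = natproj (@phi x) (proj_below x p).

Lemma proj_all_below (x y : P) (h : (x <= y)%O) p :
  proj_below x (proj_all y p) = proj_all x p.
Proof.
pose f : {lrmorphism polyring K P -> polyring K (below x)} :=
  @proj_below x y \o proj_all y.
pose g : {lrmorphism polyring K P -> polyring K (below x)} := proj_all x.
have /(_ _ p) := @polyring_hom_ext K P (polyring K (below x)) f g.
apply => z; rewrite /f /g /=.
rewrite /proj_all /proj_below /polyproj !natproj_var.
case: (insubP (below x) z) => [u zx uz|zx].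
  case: insubP => [v _ vz|]; last by rewrite (le_trans zx h).
  by rewrite natproj_var vz -uz valK.
case: insubP => [v _ vz|_]; last by rewrite raddf0.
by rewrite natproj_var vz insubN.
Qed.

Hypothesis phiC : kp_compatible.

Definition lim_map_val (p : polyring K P) : kp_prod T :=
  [ffun x : P => natproj (@phi x) (proj_all x p)].

Fact lim_map_subproof p : lim_map_val p \in lim_pred (T := T).
Proof.
by apply/asboolP => x y h; rewrite !ffunE phiC proj_all_below.
Qed.

Context (P_gt0 : (0 < #|P|)%N).

(* The map induced by the compositions K[P] -> K[(0, x]] -> T x. *)
Definition lim_map (p : polyring K P) : lim_alg T P_gt0 :=
  Lim (lim_map_subproof p).

Lemma lim_mapE p x : lim_at (lim_map p) x = natproj (@phi x) (proj_all x p).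
Proof. exact: ffunE. Qed.

Fact lim_map_is_zmod_morphism : zmod_morphism lim_map.
Proof.
move=> p q; apply: lim_ext => x.
by rewrite lim_atD lim_atN !lim_mapE !raddfB.
Qed.

Fact lim_map_is_monoid_morphism : monoid_morphism lim_map.
Proof.
split=> [|p q]; apply: lim_ext => x.
  by rewrite lim_at1 lim_mapE !rmorph1.
by rewrite lim_atM !lim_mapE !rmorphM.
Qed.

Fact lim_map_is_scalable : scalable lim_map.
Proof.
by move=> k p; apply: lim_ext => x; rewrite lim_atZ !lim_mapE !linearZ.
Qed.

HB.instance Definition _ := GRing.isZmodMorphism.Build (polyring K P)
  (lim_alg T P_gt0) lim_map lim_map_is_zmod_morphism.
HB.instance Definition _ := GRing.isMonoidMorphism.Build (polyring K P)
  (lim_alg T P_gt0) lim_map lim_map_is_monoid_morphism.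
HB.instance Definition _ := GRing.isScalable.Build K (polyring K P)
  (lim_alg T P_gt0) *:%R lim_map lim_map_is_scalable.

Definition lim_gen (x : P) : lim_alg T P_gt0 := lim_map 'x_x.

Lemma natproj_lim_gen : natproj lim_gen =1 lim_map.
Proof. by apply: polyring_hom_ext => x; apply: natproj_var. Qed.

End LimitMap.

Definition ideal_gen (R : comNzRingType) (G : R -> Prop) : {pred R} :=
  fun p => `[< exists s : seq (R * R),
    (forall u, u \in s -> G u.2) /\ p = \sum_(u <- s) u.1 * u.2 >].

Lemma ideal_gen_lin (R : comNzRingType) (G : R -> Prop) (a : R) :
  {in ideal_gen G &, forall p q, a * p + q \in ideal_gen G}.
Proof.
move=> p q /asboolP[s [sG ->]] /asboolP[t [tG ->]]; apply/asboolP.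
exists ([seq (a * u.1, u.2) | u <- s] ++ t); split=> [u|].
  by rewrite mem_cat => /orP[/mapP[v /sG ? ->]|/tG].
rewrite big_cat big_map mulr_sumr; congr (_ + _).
by apply: eq_bigr => u _; rewrite mulrA.
Qed.

Section Presentation.
Context (K : fieldType) (d : Order.disp_t) (Q : finPOrderType d).
Context (A : comAlgType K) (phi : Q -> A).

(* Elements n - r of K[Q], where n is a monomial and phi(n) = phi(r) for a    *)
(* linear combination r of standard monomials; when A is an ASL on Q^op this  *)
(* r exists and is unique for every n.                                        *)
Definition straightening_rel (g : polyring K Q) : Prop :=
  exists (n : {cmonom Q}) (r : polyring K Q),
    [/\ std_comb r, natproj phi << n >> = natproj phi r & g = << n >> - r].

Definition straightening_ideal : {pred polyring K Q} :=
  ideal_gen straightening_rel.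

Fact straightening_ideal_closed : idealr_closed straightening_ideal.
Proof.
split.
- by apply/asboolP; exists [::]; rewrite big_nil.
- apply/asboolP => -[s [sG /(congr1 (natproj phi))]].
  rewrite rmorph1 raddf_sum big1_seq => [/eqP|u /andP[_ /sG]].
    by rewrite oner_eq0.
  by case=> n [r [_ nr /= ->]]; rewrite rmorphM raddfB /= nr subrr mulr0.
- exact: ideal_gen_lin.
Qed.

HB.instance Definition _ :=
  isIdealr.Build (polyring K Q) straightening_ideal straightening_ideal_closed.

End Presentation.

Section QuotientAlgebra.
Context (K : fieldType) (A : comAlgType K) (I : idealr A).

Definition quot_scale (k : K) (q : {ideal_quot I}) : {ideal_quot I} :=
  \pi_{ideal_quot I} k%:A * q.

Fact quot_scaleA a b q : quot_scale a (quot_scale b q) = quot_scale (a * b) q.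
Proof. by rewrite /quot_scale mulrA -rmorphM mulr_algl scalerA. Qed.
Fact quot_scale1 : left_id 1 quot_scale.
Proof. by move=> q; rewrite /quot_scale scale1r rmorph1 mul1r. Qed.
Fact quot_scaleDr : right_distributive quot_scale +%R.
Proof. by move=> a q r; rewrite /quot_scale mulrDr. Qed.
Fact quot_scaleDl q : {morph quot_scale^~ q : a b / a + b}.
Proof. by move=> a b; rewrite /quot_scale scalerDl raddfD /= mulrDl. Qed.

HB.instance Definition _ := GRing.Zmodule_isLmodule.Build K {ideal_quot I}
  quot_scaleA quot_scale1 quot_scaleDr quot_scaleDl.

Fact quot_scaleAl (k : K) (q r : {ideal_quot I}) : k *: (q * r) = (k *: q) * r.
Proof. exact: mulrA. Qed.

HB.instance Definition _ :=
  GRing.Lmodule_isLalgebra.Build K {ideal_quot I} quot_scaleAl.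
HB.instance Definition _ := GRing.Lalgebra_isComAlgebra.Build K {ideal_quot I}.

End QuotientAlgebra.

(* Main.v *)
Require Import Defs.
From HB Require Import structures.
From mathcomp Require Import all_boot all_order all_algebra finmap.
From mathcomp.multinomials Require Import monalg.
From mathcomp Require Import boolp.

Import Order.TTheory GRing.Theory.
Local Open Scope ring_scope.
Local Open Scope quotient_scope.

(** The limit has the standard monomials of P as a basis because the [T x] do so
    locally. In terms of coefficients, the projection K[P] -> K[(0, x]] just
    forgets the monomials whose support is not contained in (0, x]
    ([mcoeff_proj_all]). The support of a standard monomial is a chain, so it
    lies in (0, z] for some z, and for z one can take the maximum of the chain
    when the monomial is not 1 ([standard_max], [standard_bounded]). So every
    coefficient of a combination of standard monomials is visible in one of
    the algebras [T z], where standard monomials are free.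

    Linear independence follows at once. For generation, an element a of the
    limit has in each component x a unique standard expression, and the
    compatibility of the components says that the coefficient at m is the same
    in components x <= y as soon as m is supported in (0, x]. For m <> 1 all the
    components that see m therefore agree with the component at the maximum of
    the support of m. The monomial 1 is seen everywhere, and its coefficient is
    constant because P is connected. The common coefficients define a
    combination of standard monomials of P mapping to a ([lim_span]).

    For the straightening condition let m occur in the expansion r of
    phi(x) phi(y) and let (0, z] contain the support of m. The image of r in
    [T z] is not zero, so x <= z and y <= z, as otherwise the product dies
    there. Then condition ASL2 of [T z] applies to x, y and m
    ([lim_straight]).

    The presentation holds for any ASL A: modulo the straightening relations a
    polynomial is congruent to a combination of standard monomials, and this
    combination is zero if its image in A is ([straightening_ideal_ker]). *)

(** * Monomials and coefficients over a finite set of variables *)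

Section FiniteMonomials.
Set Implicit Arguments.
Unset Strict Implicit.
Context (K : fieldType) (I : finType).

Definition monom_of (f : I -> nat) : {cmonom I} :=
  [cmonom f i | i in [fset i in {: I}]%fset]%M.

Lemma monom_ofE f i : monom_of f i = f i.
Proof. by rewrite cmE fsfunE !inE. Qed.

Lemma monom_eqP (m1 m2 : {cmonom I}) : m1 =1 m2 -> m1 = m2.
Proof. by move=> E; apply/eqP/cmP. Qed.

Lemma mcoeff_monom (m k : {cmonom I}) :
  (<< m >> : polyring K I)@_k = (m == k)%:R.
Proof. exact: mcoeffU1. Qed.

Lemma mcoeff_var i (m : {cmonom I}) :
  ('x_i : polyring K I)@_m = (@ucm I i == m)%:R.
Proof. exact: mcoeff_monom. Qed.

Lemma monalg_sum (p : polyring K I) :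
  p = \sum_(m <- msupp p) p@_m *: << m >>.
Proof.
by rewrite {1}[p]monalgE; apply: eq_bigr => m _; rewrite polyring_monomZ.
Qed.

Lemma mcoeff_polyZ (c : K) (p : polyring K I) m : (c *: p)@_m = c * p@_m.
Proof. exact: mcoeffZ. Qed.

Lemma mcoeff_linear (J : finType) (f : {linear polyring K I -> polyring K J})
    (p : polyring K I) k :
  (f p)@_k = \sum_(m <- msupp p) p@_m * (f << m >>)@_k.
Proof.
rewrite {1}[p]monalg_sum !raddf_sum; apply: eq_bigr => m _ /=.
by rewrite linearZ /= mcoeffZ.
Qed.

End FiniteMonomials.

(** * Standard monomials *)

Section StandardMonomials.
Set Implicit Arguments.
Unset Strict Implicit.
Context (K : fieldType) (d : Order.disp_t) (Q : finPOrderType d).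
Implicit Types (m : {cmonom Q}) (p q : polyring K Q).

Lemma std_combB p q : std_comb p -> std_comb q -> std_comb (p - q).
Proof.
move=> sp sq m; rewrite mcoeffB.
have [->|/sp//] := eqVneq p@_m 0; have [->|/sq//] := eqVneq q@_m 0.
by rewrite subrr eqxx.
Qed.

Lemma std_comb_sum (I : eqType) (s : seq I) (c : I -> K)
    (F : I -> polyring K Q) :
  {in s, forall i, std_comb (F i)} -> std_comb (\sum_(i <- s) c i *: F i).
Proof.
move=> sF m; rewrite raddf_sum /= => nz.
have [[i si Fi]|no] := pselect (exists2 i, i \in s & (F i)@_m != 0).
  exact: sF Fi.
move: nz; rewrite big1_seq ?eqxx // => i /andP[_ si].
rewrite mcoeff_polyZ; have [->|Fi] := eqVneq (F i)@_m 0; first by rewrite mulr0.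
by case: no; exists i.
Qed.

Lemma std_comb_var (z : Q) : std_comb ('x_z : polyring K Q).
Proof.
move=> m; rewrite mcoeff_var.
case: (@ucm Q z =P m) => [<-|]; last by rewrite eqxx.
move=> _ u v; rewrite !cmU; case: (z =P u) => // <-; case: (z =P v) => // <-.
by rewrite comparablexx.
Qed.

Lemma polyvar_inj : injective (@polyvar K Q).
Proof.
move=> x y xy; have := mcoeff_var K x (@ucm Q x).
rewrite xy (mcoeff_var K y) eqxx.
case: (@ucm Q y =P ucm x) => [yx _|_ /esym/eqP]; last by rewrite oner_eq0.
have := congr1 (fun m : {cmonom Q} => m x) yx; rewrite !cmU eqxx.
by case: (y =P x).
Qed.

Section Free.
Context (A : comAlgType K) (phi : Q -> A).
Hypothesis free : forall p, std_comb p -> natproj phi p = 0 -> p = 0.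

Lemma std_comb_inj p q :
  std_comb p -> std_comb q -> natproj phi p = natproj phi q -> p = q.
Proof.
move=> sp sq pq; apply/eqP; rewrite -subr_eq0; apply/eqP.
by apply: (free (std_combB sp sq)); rewrite raddfB /= pq subrr.
Qed.

(** The generators are themselves standard monomials, so the injectivity
    required of an ASL structure is a case of linear independence. *)
Lemma free_gen_inj : injective phi.
Proof.
move=> x y xy; suff E : natproj phi 'x_x = natproj phi 'x_y.
  exact: polyvar_inj (std_comb_inj (@std_comb_var x) (@std_comb_var y) E).
apply: etrans (natproj_var phi x) _; apply: etrans xy _.
exact: esym (natproj_var phi y).
Qed.

End Free.

Definition bounded_by m (x : Q) := forall w, m w != 0%N -> (w <= x)%O.

Lemma standard_max m w0 : standard m -> m w0 != 0%N ->
  exists2 z, m z != 0%N & bounded_by m z.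
Proof.
move=> sm mw0.
(* On a chain, the number of elements below z is strictly increasing in z, so *)
(* its maximiser on the support is the maximum of the support.               *)
pose h z := #|[set u : Q | (u <= z)%O]|.
case: (@arg_maxnP _ w0 (fun w => m w != 0%N) h mw0) => z mz zmax.
exists z => // w mw; case: (comparable_ltgtP (sm w z mw mz)) => // zw.
have : (h w <= h z)%N := zmax w mw; rewrite /h leqNgt => /negP[].
apply: proper_card.
apply/properP; split.
  by apply/subsetP=> u; rewrite !inE => /le_trans-> //; apply: ltW.
by exists w; rewrite !inE ?lexx // lt_geF.
Qed.

(** Here the bound need not be in the support, so that m = 1 is covered too. *)
Lemma standard_bounded (Q_gt0 : (0 < #|Q|)%N) m :
  standard m -> exists z, bounded_by m z.
Proof.
move=> sm; have [[w mw]|m1] := pselect (exists w, m w != 0%N).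
  by have [z _ mz] := standard_max sm mw; exists z.
have /card_gt0P[z _] := Q_gt0.
by exists z => w mw; case: m1; exists w.
Qed.

End StandardMonomials.

(** * The projection to the variables below an element *)

Section Restriction.
Set Implicit Arguments.
Unset Strict Implicit.
Context (K : fieldType) (d : Order.disp_t) (P : finPOrderType d) (x : P).
Implicit Types (m : {cmonom P}) (k : {cmonom (below x)}).

Definition restr_monom m : {cmonom (below x)} :=
  monom_of (fun y : below x => m (val y)).

Definition ext_monom k : {cmonom P} :=
  monom_of (fun z => if insub z is Some y then k y else 0%N).

Lemma restr_monomE m y : restr_monom m y = m (val y).
Proof. exact: monom_ofE. Qed.

Lemma ext_monom_val k y : ext_monom k (val y) = k y.
Proof. by rewrite monom_ofE valK. Qed.

Lemma ext_monom_supp k w :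
  ext_monom k w != 0%N -> exists2 y : below x, val y = w & k y != 0%N.
Proof. by rewrite monom_ofE; case: insubP => // y _ <- ky; exists y. Qed.

Lemma ext_monom_bounded k : bounded_by (ext_monom k) x.
Proof. by move=> w /ext_monom_supp[y <- _]; apply: (valP y). Qed.

Lemma ext_monomK : cancel ext_monom restr_monom.
Proof.
by move=> k; apply: monom_eqP => y; rewrite restr_monomE ext_monom_val.
Qed.

Lemma restr_monomK m : bounded_by m x -> ext_monom (restr_monom m) = m.
Proof.
move=> mx; apply: monom_eqP => w; rewrite monom_ofE.
case: insubP => [y _ <-|wx]; first by rewrite restr_monomE.
by apply/esym/eqP; apply: contraNT wx => /mx.
Qed.

Lemma standard_ext k : standard k <-> standard (ext_monom k).
Proof.
split=> sk u v.
  by move=> /ext_monom_supp[y <- ky] /ext_monom_supp[z <- kz]; apply: sk.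
move=> ku kv.
have := sk (val u) (val v); rewrite !ext_monom_val => /(_ ku kv).
by rewrite /Order.comparable !leEsub.
Qed.

Lemma proj_all_var_val (y : below x) :
  proj_all x 'x_(val y) = 'x_y :> polyring K _.
Proof. by rewrite /proj_all /polyproj natproj_var valK. Qed.

Lemma proj_all_var_out z : ~~ (z <= x)%O -> proj_all x 'x_z = 0 :> polyring K _.
Proof. by move=> zx; rewrite /proj_all /polyproj natproj_var insubN. Qed.

Lemma proj_all_ext k :
  proj_all x << ext_monom k >> = << k >> :> polyring K (below x).
Proof.
rewrite [LHS](congr1 _ (polyring_monomE _ _)) rmorph_prod.
(* The variables not below x have exponent 0 in ext_monom k. *)
rewrite [RHS]polyring_monomE [LHS](bigID (fun z => z <= x)%O) /=.
rewrite [X in _ * X]big1 ?mulr1 => [|z zx]; last first.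
  by rewrite monom_ofE insubN ?expr0 ?rmorph1.
rewrite (reindex_omap (val : below x -> P) insub) => [|z zx]; last first.
  by rewrite insubT.
apply: eq_big => [y|y _]; first by rewrite valK eqxx andbT; apply: (valP y).
by rewrite rmorphXn /= proj_all_var_val ext_monom_val.
Qed.

Lemma proj_all_monom0 m w : m w != 0%N -> ~~ (w <= x)%O ->
  proj_all x << m >> = 0 :> polyring K (below x).
Proof.
move=> mw wx; rewrite [LHS](congr1 _ (polyring_monomE _ _)) rmorph_prod.
rewrite (bigD1 w) //= [X in X * _]rmorphXn /= proj_all_var_out //.
by rewrite expr0n (negPf mw); apply: mul0r.
Qed.

(** By linearity it is enough to look at a monomial m: either m is supported
    below x and is then the extension of its own restriction, or the
    projection kills it. *)
Lemma mcoeff_proj_all (p : polyring K P) k :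
  (proj_all x p)@_k = p@_(ext_monom k).
Proof.
rewrite mcoeff_linear [RHS](congr1 _ (monalg_sum _)) raddf_sum.
apply: eq_bigr => m _ /=; rewrite mcoeff_polyZ mcoeff_monom; congr (_ * _).
have [mx|nmx] := pselect (bounded_by m x).
  rewrite -(restr_monomK mx) proj_all_ext mcoeff_monom.
  by rewrite (can_eq ext_monomK).
have /existsNP[w /not_implyP[mw /negP wx]] := nmx.
rewrite (proj_all_monom0 mw wx) mcoeff0 -[LHS](mulr0n 1); congr (_ *+ _).
by case: eqP => // mk; case: nmx; rewrite mk; apply: ext_monom_bounded.
Qed.

Lemma mcoeff_proj_all_restr (p : polyring K P) m : bounded_by m x ->
  (proj_all x p)@_(restr_monom m) = p@_m.
Proof. by move=> mx; rewrite mcoeff_proj_all restr_monomK. Qed.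

Lemma eq_proj_all (p q : polyring K P) :
  (forall m, bounded_by m x -> p@_m = q@_m) -> proj_all x p = proj_all x q.
Proof.
move=> pq; apply/malgP => k; apply: etrans (mcoeff_proj_all p k) _.
apply: etrans (pq _ (@ext_monom_bounded k)) _.
exact: esym (mcoeff_proj_all q k).
Qed.

Lemma std_comb_proj (p : polyring K P) : std_comb p -> std_comb (proj_all x p).
Proof. by move=> sp k; rewrite mcoeff_proj_all => /sp /standard_ext. Qed.

Lemma std_comb_lift (p : polyring K (below x)) : std_comb p ->
  exists2 q : polyring K P, std_comb q & proj_all x q = p.
Proof.
move=> sp; exists (\sum_(k <- msupp p) p@_k *: << ext_monom k >>).
  apply: std_comb_sum => k; rewrite -mcoeff_neq0 => /sp/standard_ext sk m.
  by rewrite mcoeff_monom; case: (ext_monom k =P m) => [<-|]; rewrite ?eqxx.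
rewrite raddf_sum [RHS]monalg_sum; apply: eq_bigr => k _ /=.
by rewrite linearZ /= proj_all_ext.
Qed.

End Restriction.

(** * Presentation of an ASL by its straightening relations *)

Section Presentation.
Set Implicit Arguments.
Unset Strict Implicit.
Context (K : fieldType) (d : Order.disp_t) (Q : finPOrderType d).
Context (A : comAlgType K) (phi : Q -> A).
Local Notation J := (straightening_ideal phi).

Lemma straightening_ideal_sub_ker p : p \in J -> natproj phi p = 0.
Proof.
move=> /asboolP[s [sG ->]]; rewrite raddf_sum big1_seq // => u /andP[_ /sG].
by case=> n [r [_ nr /= ->]]; rewrite rmorphM raddfB /= nr subrr mulr0.
Qed.

(** The map is defined by representatives; it does not depend on them because
    the ideal is contained in the kernel. *)
Definition straightening_map (q : {ideal_quot J}) : A := natproj phi (repr q).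

Lemma straightening_map_pi p : straightening_map (\pi p) = natproj phi p.
Proof.
apply/eqP; rewrite -subr_eq0 -raddfB; apply/eqP/straightening_ideal_sub_ker.
by rewrite Quotient.idealrBE reprK.
Qed.

Fact straightening_map_zmod_morphism : zmod_morphism straightening_map.
Proof.
move=> u v; rewrite -[u]reprK -[v]reprK -raddfB !straightening_map_pi.
exact: raddfB.
Qed.

Fact straightening_map_monoid_morphism : monoid_morphism straightening_map.
Proof.
split=> [|u v].
  by rewrite -(rmorph1 (\pi_{ideal_quot J})) straightening_map_pi rmorph1.
by rewrite -[u]reprK -[v]reprK -rmorphM !straightening_map_pi rmorphM.
Qed.

Fact straightening_map_scalable : scalable straightening_map.
Proof.
move=> c u; rewrite -[u]reprK /GRing.scale /= /quot_scale -rmorphM.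
by rewrite !straightening_map_pi mulr_algl linearZ.
Qed.

HB.instance Definition _ := GRing.isZmodMorphism.Build _ _
  straightening_map straightening_map_zmod_morphism.
HB.instance Definition _ := GRing.isMonoidMorphism.Build _ _
  straightening_map straightening_map_monoid_morphism.
HB.instance Definition _ := GRing.isScalable.Build K _ _ *:%R
  straightening_map straightening_map_scalable.

Hypothesis aslA : is_asl_op phi.

(** Each monomial is congruent, by a generator of the ideal, to its standard
    expression; the general case follows by linearity. *)
Lemma straighten_mod_ideal p : exists2 r, std_comb r & p - r \in J.
Proof.
have /choice[r rP] (m : {cmonom Q}) : exists r : polyring K Q,
    std_comb r /\ natproj phi r = natproj phi << m >>.
  by have [r] := asl_span aslA (natproj phi << m >>); exists r.
exists (\sum_(m <- msupp p) p@_m *: r m).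
  by apply: std_comb_sum => m _; apply: (rP m).1.
apply/asboolP.
exists [seq ((p@_m)%:A, << m >> - r m) | m <- msupp p]; split.
  by move=> u /mapP[m _ ->]; exists m, (r m); case: (rP m).
rewrite big_map {1}[p]monalg_sum -sumrB; apply: eq_bigr => m _ /=.
by rewrite mulr_algl scalerBr.
Qed.

(** The standard combination congruent to p has the same image 0 as p, so it is
    0 by linear independence. *)
Lemma straightening_ideal_ker p : natproj phi p = 0 -> p \in J.
Proof.
move=> p0; have [r sr prJ] := straighten_mod_ideal p.
suff r0 : r = 0 by rewrite r0 subr0 in prJ.
apply: (asl_free aslA sr); apply/eqP; rewrite -oppr_eq0 -{1}p0.
have /eqP := straightening_ideal_sub_ker prJ.
by rewrite raddfB /= p0 sub0r.
Qed.

Lemma straightening_map_bij : bijective straightening_map.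
Proof.
have /choice[g gP] (a : A) : exists p, natproj phi p = a.
  by have [p] := asl_span aslA a; exists p.
exists (fun a => \pi_{ideal_quot J} (g a)) => [u|a]; last first.
  by rewrite straightening_map_pi.
rewrite -[RHS]reprK; apply/eqP; rewrite -Quotient.idealrBE.
by apply: straightening_ideal_ker; rewrite raddfB /= gP subrr.
Qed.

End Presentation.

(** * The ASL structure on the limit *)

Section LimitASL.
Set Implicit Arguments.
Unset Strict Implicit.
Context (K : fieldType) (d : Order.disp_t) (P : finPOrderType d).
Context (P_gt0 : (0 < #|P|)%N) (P_conn : connected_poset P).
Context (T : kp_algebra K P) (phi : forall x : P, below x -> T x).
Hypothesis aslT : forall x : P, is_asl_op (@phi x).
Hypothesis phiC : kp_compatible phi.

(** Equality in the single component x determines all coefficients at monomials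
    supported in (0, x], since standard monomials are free in [T x]. *)
Lemma lim_mcoeff_eq x (p q : polyring K P) m :
  std_comb p -> std_comb q -> bounded_by m x ->
  natproj (@phi x) (proj_all x p) = natproj (@phi x) (proj_all x q) ->
  p@_m = q@_m.
Proof.
move=> sp sq mx pq; rewrite -(mcoeff_proj_all_restr p mx).
rewrite -(mcoeff_proj_all_restr q mx).
have -> // : proj_all x p = proj_all x q.
apply: (@std_comb_inj K d _ (T x) (@phi x)).
- by case: (aslT x).
- exact: std_comb_proj.
- exact: std_comb_proj.
- exact: pq.
Qed.

Lemma lim_mcoeff0 x (p : polyring K P) m : std_comb p -> bounded_by m x ->
  natproj (@phi x) (proj_all x p) = 0 -> p@_m = 0.
Proof.
move=> sp mx /(asl_free (aslT x) (std_comb_proj sp)) p0.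
by rewrite -(mcoeff_proj_all_restr p mx) p0 mcoeff0.
Qed.

Lemma lim_free p : std_comb p -> lim_map phiC P_gt0 p = 0 -> p = 0.
Proof.
move=> sp p0; apply/malgP => m; rewrite mcoeff0.
have [//|pm] := eqVneq p@_m 0.
have [z mz] := standard_bounded P_gt0 (sp m pm).
apply: (lim_mcoeff0 sp mz); rewrite -(lim_mapE phiC P_gt0) p0.
exact: kp_prod0E.
Qed.

Lemma connected_const (U : Type) (f : P -> U) :
  (forall x y, (x <= y)%O -> f x = f y) -> forall x y, f x = f y.
Proof.
move=> fle x y; have /connectP[s] := P_conn x y.
elim: s x => [|u s IH] x /=; first by move=> _ ->.
case/andP=> /orP[xu|ux] sP yE.
  by rewrite (fle _ _ xu); apply: IH.
by rewrite -(fle _ _ ux); apply: IH.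
Qed.

(** The coefficient of a monomial m in the combination to be found is read off
    from any component x such that m is supported in (0, x]; the point is that
    the choice of x does not matter. *)
Lemma lim_span (a : lim_alg T P_gt0) :
  exists2 p, std_comb p & lim_map phiC P_gt0 p = a.
Proof.
have /choice[q qP] x : exists q : polyring K P,
    std_comb q /\ natproj (@phi x) (proj_all x q) = lim_at a x.
  have [p sp <-] := asl_span (aslT x) (lim_at a x).
  by have [q sq <-] := std_comb_lift sp; exists q.
have q_le x y m : (x <= y)%O -> bounded_by m x -> (q x)@_m = (q y)@_m.
  move=> xy mx; have [[sx xE] [sy yE]] := (qP x, qP y).
  apply: (lim_mcoeff_eq sx sy mx); apply: (etrans xE).
  rewrite -(limP a xy) -yE phiC.
  by apply: (congr1 (natproj (@phi x))); apply: proj_all_below.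
have q_eq x y m : bounded_by m x -> bounded_by m y -> (q x)@_m = (q y)@_m.
  move=> mx my; have [[w mw]|m1] := pselect (exists w, m w != 0%N); last first.
    (* The case m = 1, a monomial supported in every (0, z]. *)
    apply: (@connected_const _ (fun z => (q z)@_m)) => u v uv.
    by apply: q_le => // w mw; case: m1; exists w.
  have [sm|nsm] := pselect (standard m).
    (* Both coefficients are that of the component at the maximum of supp m. *)
    have [z mz zmax] := standard_max sm mw.
    by rewrite -(q_le z x) -?(q_le z y) //; [apply: my|apply: mx].
  have q0 z : (q z)@_m = 0.
    by have [//|/(qP z).1/nsm] := eqVneq (q z)@_m 0.
  by rewrite !q0.
pose c m := if [pick x | `[< bounded_by m x >]] is Some x then (q x)@_m else 0.
have cE x m : bounded_by m x -> c m = (q x)@_m.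
  rewrite /c; case: pickP => [y /asboolP my mx|no mx]; first exact: q_eq.
  by have /asboolP := no x.
pose D := (\bigcup_(x <- enum P) msupp (q x))%fset.
pose p : polyring K P := [malg m in D => c m].
have pE x m : bounded_by m x -> p@_m = (q x)@_m.
  move=> mx; rewrite mcoeffE (cE x) //; case: ifP => // mD.
  apply/esym/eqP; rewrite mcoeff_eq0; apply: contraFN mD => mq.
  by apply/bigfcupP; exists x => //; rewrite mem_enum.
have sp : std_comb p.
  move=> m; rewrite mcoeffE; case: ifP => _; last by rewrite eqxx.
  rewrite /c; case: pickP => [x _|_]; last by rewrite eqxx.
  exact: (qP x).1.
exists p; first exact: sp.
apply: lim_ext => x; apply: (etrans (lim_mapE phiC P_gt0 p x)).
rewrite -(qP x).2; apply: (congr1 (natproj (@phi x))).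
by apply: eq_proj_all => m; apply: pE.
Qed.

(** The condition is inherited from a component [T z] such that m is supported
    in (0, z]. The component at z of phi(x) is 0 unless x <= z, so x and y are
    also elements of (0, z], since m occurs in their product. *)
Lemma lim_straight (x y : P) (r : polyring K P) :
  (x >< y)%O -> std_comb r ->
  lim_map phiC P_gt0 ('x_x * 'x_y) = lim_map phiC P_gt0 r ->
  forall m, r@_m != 0 ->
    exists z : P, [/\ m z != 0%N, (forall w, m w != 0%N -> (w <= z)%O),
                        (x < z)%O & (y < z)%O].
Proof.
move=> xy sr rE m rm.
have [z mz] := standard_bounded P_gt0 (sr m rm).
have rz : natproj (@phi z) (proj_all z 'x_x) *
    natproj (@phi z) (proj_all z 'x_y) = natproj (@phi z) (proj_all z r).
  apply: etrans (lim_mapE phiC P_gt0 r z); rewrite -rE.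
  apply: etrans (esym (lim_mapE phiC P_gt0 ('x_x * 'x_y) z)).
  by rewrite [proj_all z (_ * _)]rmorphM [RHS]rmorphM.
have vanish u : ~~ (u <= z)%O -> natproj (@phi z) (proj_all z 'x_u) = 0.
  by move=> uz; rewrite proj_all_var_out ?raddf0.
have nz : natproj (@phi z) (proj_all z r) <> 0.
  by move=> r0; move: rm; rewrite (lim_mcoeff0 sr mz r0) eqxx.
have [xz|/vanish x0] := boolP (x <= z)%O; last first.
  case: nz; apply: etrans (esym rz) _.
  exact: etrans (congr1 ( *%R^~ _) x0) (mul0r _).
have [yz|/vanish y0] := boolP (y <= z)%O; last first.
  case: nz; apply: etrans (esym rz) _.
  exact: etrans (congr1 ( *%R _) y0) (mulr0 _).
have gen (u : below z) : natproj (@phi z) (proj_all z 'x_(val u)) = @phi z u.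
  by rewrite proj_all_var_val natproj_var.
pose x' : below z := Sub x xz; pose y' : below z := Sub y yz.
have x'y' : (x' >< y')%O by move: xy; rewrite /Order.comparable !leEsub.
have rE' : @phi z x' * @phi z y' = natproj (@phi z) (proj_all z r).
  exact: etrans (esym (congr2 *%R (gen x') (gen y'))) rz.
have rm' : (proj_all z r)@_(restr_monom z m) != 0.
  by rewrite (mcoeff_proj_all_restr r mz).
have [t [mt tmax xt yt]] :=
  asl_straight (aslT z) x'y' (std_comb_proj sr) rE' rm'.
rewrite restr_monomE in mt; exists (val t); split=> [|w mw||].
- exact: mt.
- have mw' : restr_monom z m (Sub w (mz w mw)) != 0%N by rewrite restr_monomE.
  by have := tmax _ mw'; rewrite leEsub.
- by move: xt; rewrite ltEsub.
- by move: yt; rewrite ltEsub.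
Qed.

Lemma lim_gen_free p :
  std_comb p -> natproj (lim_gen phiC P_gt0) p = 0 -> p = 0.
Proof. by move=> sp p0; apply: lim_free sp _; rewrite -natproj_lim_gen. Qed.

Lemma lim_is_asl : is_asl_op (lim_gen phiC P_gt0).
Proof.
split.
- exact: free_gen_inj lim_gen_free.
- exact: lim_gen_free.
- by move=> a; have [p sp <-] := lim_span a; exists p; rewrite ?natproj_lim_gen.
- move=> x y r xy sr rE; apply: (lim_straight xy sr).
  apply: etrans (rmorphM (lim_map phiC P_gt0) _ _) _.
  by apply: etrans rE _; apply: natproj_lim_gen.
Qed.

End LimitASL.

Theorem theorem4p1 (K : fieldType) (d : Order.disp_t) (P : finPOrderType d)
    (P_gt0 : (0 < #|P|)%N) (P_conn : connected_poset P)
    (T : kp_algebra K P) (phi : forall x : P, below x -> T x)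
    (aslT : forall x : P, is_asl_op (phi x))
    (phiC : kp_compatible phi) :
  is_asl_op (lim_gen phiC P_gt0) /\
  exists f : {lrmorphism {ideal_quot straightening_ideal (lim_gen phiC P_gt0)}
                         -> lim_alg T P_gt0},
    bijective f /\
    forall p : polyring K P,
      f (\pi_{ideal_quot straightening_ideal (lim_gen phiC P_gt0)} p)
        = natproj (lim_gen phiC P_gt0) p.
Proof.
have aslL := lim_is_asl P_gt0 P_conn aslT phiC.
split=> //; exists (@straightening_map K d P _ (lim_gen phiC P_gt0)).
split; first exact: straightening_map_bij.
exact: straightening_map_pi.
Qed.
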